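(* Let $\vec{\lambda}=\langle\lambda_n : n<\omega\rangle$ be a strictly increasing sequence of measurable cardinals with limit $\lambda$ and let $\vec{\mathcal{U}}=\langle U_n : n<\omega\rangle$ be a sequence such that $U_n$ is a normal ultrafilter on $\lambda_n$ for every $n<\omega$. Then there exists a subset of $C(\vec{\lambda})$ without the $\vec{\mathcal{U}}$-Baire property.
   Context: $C(\vec{\lambda})=\prod_{n<\omega}\lambda_n=\{x:\omega\to\lambda \mid \forall n\ x(n)<\lambda_n\}$. The diagonal Prikry forcing $\mathbb{P}$ with $\vec{\mathcal{U}}$: conditions are sequences $p=\langle p_i:i<\omega\rangle$ for which there is $n<\omega$ with $p_i<\lambda_i$ for $i<n$ and $p_i\in U_i$ for $i\ge n$; then $s^p=\langle p_0,\ldots,p_{n-1}\rangle$ (the stem), $\mathrm{lh}(p)=n$, and $A^p_i=p_i$ for $i\ge n$. For each condition $p$, let $N_p=\{x\in C(\vec{\lambda}) : x(i)=s^p(i)$ for all $i<\mathrm{lh}(p)$ and $x(i)\in A^p_i$ for all $i\ge\mathrm{lh}(p)\}$. The $\vec{\mathcal{U}}$-EP (Ellentuck–Prikry) topology on $C(\vec{\lambda})$ is the topology with basic open sets $N_p$, $p\in\mathbb{P}$. In a topological space, a set is $\lambda$-meager if it is a union of at most $\lambda$ many nowhere dense sets, and a set $A$ has the $\lambda$-Baire property if there is an open $U$ with $A\,\Delta\,U$ $\lambda$-meager. $A\subseteq C(\vec{\lambda})$ has the $\vec{\mathcal{U}}$-Baire property if it has the $\lambda$-Baire property with respect to the $\vec{\mathcal{U}}$-EP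 topology. *)

(* Defs.v *)
From HB Require Import structures.
From mathcomp Require Import all_boot all_order.
From mathcomp Require Import all_classical topology.

Set Implicit Arguments.
Unset Strict Implicit.
Unset Printing Implicit Defensive.

Import Order.TTheory.

Local Open Scope classical_set_scope.
Local Open Scope card_scope.
Local Open Scope order_scope.

(* Ordinals are elements of an arbitrary well-ordered type [O]; [below k] is *)
(* the von Neumann ordinal [k], i.e. the type of all ordinals less than [k]. *)
Definition below d (O : orderType d) (k : O) : Type := {a : O | a < k}.

Section Ultrafilters.
Context d (O : orderType d).
Implicit Types k : O.

(* Cardinals are initial ordinals. *)
Definition is_cardinal k : Prop :=
  forall a, a < k -> ~ ([set: below k] #<= [set: below a]).

Definition nonprincipal T (U : set_system T) : Prop := forall t, ~ U [set t].

(* closed under intersections of fewer than k sets *)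
Definition complete_below k (U : set_system (below k)) : Prop :=
  forall F : set (set (below k)), F `<=` U -> ~ ([set: below k] #<= F) ->
    U (\bigcap_(A in F) A).

Definition diagonal_intersection k (A : below k -> set (below k)) :
    set (below k) :=
  [set b | forall a, val a < val b -> A a b].

Definition measurable_cardinal k : Prop :=
  [/\ is_cardinal k, ~ countable [set: below k] &
      exists U : set_system (below k),
        [/\ UltraFilter U, nonprincipal U & complete_below U]].

Record normal_ultrafilter k (U : set_system (below k)) : Prop := {
  normal_ultra : UltraFilter U;
  normal_nonprincipal : nonprincipal U;
  normal_complete : complete_below U;
  normal_diagonal : forall A : below k -> set (below k),
    (forall a, U (A a)) -> U (diagonal_intersection A)
}.

End Ultrafilters.

Section BaireProperty.
Context (T : topologicalType).

Definition nowhere_dense (A : set T) : Prop := (closure A)° = set0.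

(* In the next two definitions the cardinal is given by a type [K] of that *)
(* cardinality. *)
Definition meager_at (K : Type) (A : set T) : Prop :=
  exists F : set (set T),
    [/\ F #<= [set: K], F `<=` nowhere_dense & A = \bigcup_(B in F) B].

Definition Baire_property_at (K : Type) (A : set T) : Prop :=
  exists2 V : set T, open V & meager_at K (A `+` V).

End BaireProperty.

Section DiagonalPrikry.
Context d (O : orderType d) (lam : nat -> O).
Variable U : forall n, set_system (below (lam n)).
Arguments U : clear implicits.

(* A term of type [forall i, below (lam i) + set (below (lam i))] is a *)
(* sequence each of whose entries is either an ordinal below [lam i] ([inl]) *)
(* or a subset of [lam i] ([inr]). *)
Definition Prikry_condition
    (p : forall i, below (lam i) + set (below (lam i))) : Prop :=
  exists n : nat,
    (forall i, (i < n)%N -> exists a, p i = inl a) /\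
    (forall i, (n <= i)%N -> exists2 A, U i A & p i = inr A).

Definition Prikry_nbhd (p : forall i, below (lam i) + set (below (lam i))) :
    set (forall i, below (lam i)) :=
  [set x | forall i, match p i with inl a => x i = a | inr A => A (x i) end].

Hypothesis normU : forall n, normal_ultrafilter (U n).

(* The product of the [lam n]. It depends on [normU] because the sets *)
(* [Prikry_nbhd p] form a base only when the [U n] are filters. *)
Definition EPspace & forall n, normal_ultrafilter (U n) : Type :=
  forall n, below (lam n).

HB.instance Definition _ := gen_eqMixin (EPspace normU).
HB.instance Definition _ := gen_choiceMixin (EPspace normU).

Definition EPbase : set (set (EPspace normU)) :=
  [set Prikry_nbhd p | p in Prikry_condition].

Lemma EPbase_cover : \bigcup_(B in EPbase) B = [set: EPspace normU].
Proof.
apply/seteqP; split => // x _; exists setT => //.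
exists (fun=> inr setT); last by apply/seteqP; split.
exists 0%N; split => // i _; exists setT => //.
by have [[? ?] _ _ _] := normU i; exact: filterT.
Qed.

Lemma EPbase_join (B C : set (EPspace normU)) x :
  EPbase B -> EPbase C -> B x -> C x ->
  exists D, [/\ EPbase D, D x & D `<=` B `&` C].
Proof.
move=> [p [n [pl pr]] <-] [q [m [ql qr]] <-] px qx.
pose r i : below (lam i) + set (below (lam i)) :=
  if p i is inr A then if q i is inr A' then inr (A `&` A') else inl (x i)
  else inl (x i).
exists (Prikry_nbhd r); split.
- exists r => //; exists (maxn n m); split => i.
    rewrite leq_max /r => /orP[/pl [a ->]|/ql [a ->]]; first by exists (x i).
    by case: (p i) => [b|A]; exists (x i).
  rewrite geq_max /r => /andP[/pr [A UA ->] /qr [A' UA' ->]].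
  by exists (A `&` A') => //; have [[? ?] _ _ _] := normU i; exact: filterI.
- by move=> i; move: (px i) (qx i); rewrite /r; case: (p i); case: (q i).
- move=> y ry; split=> i; move: (ry i) (px i) (qx i); rewrite /r.
    by case: (p i) => [a|A]; case: (q i) => [b|A']; by [move=> ->|case].
  by case: (p i) => [a|A]; case: (q i) => [b|A']; by [move=> ->|case].
Qed.

HB.instance Definition _ :=
  @isBaseTopological.Build (EPspace normU) (set (EPspace normU)) EPbase id
    EPbase_cover (fun B C x => @EPbase_join B C x).

End DiagonalPrikry.

Definition EP_Baire_property d (O : orderType d) (lam : nat -> O) (l : O)
    (U : forall n, set_system (below (lam n)))
    (normU : forall n, normal_ultrafilter (U n))
    (A : set (EPspace normU)) : Prop :=
  Baire_property_at (below l) A.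

(* Main.v *)
Require Import Defs.
From mathcomp Require Import all_boot all_order.
From mathcomp Require Import all_classical wochoice topology.

Import eqtype Order.TTheory.

Local Open Scope classical_set_scope.
Local Open Scope order_scope.

(** Every nowhere dense set [B] is avoided by all points that eventually run
    through a suitable sequence [A i \in U i]: call a stem good if some condition
    with that stem has a neighbourhood disjoint from [B].  By the ultrafilter
    property a bad stem has [U]-many bad one-point extensions, so, by
    completeness, a bad stem would yield a condition all of whose extensions have
    bad stems, against nowhere density.  Hence every stem is good, and the
    witnesses for all stems can be intersected because there are fewer than
    [lam i] stems of length at most [i].  Diagonalizing once more, an [l]-meager
    set is also avoided by all points that are eventually in one sequence [A].

    A set without the Baire property: fix representatives of equality modulo
    finite and collect the points whose last difference from their
    representative is at an odd index.  Inside each basic open set, and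
    eventually inside any [A], the parity of that index can be prescribed. *)

(** Invert the injection of [F] into [K]; indices outside its range get the default [x0], which also
    covers an empty [F]. *)
Lemma enum_of_card_le {T K : Type} (F : set T) (x0 : T) :
  (F #<= [set: K])%card ->
  exists2 e : K -> T, (forall k, F (e k) \/ e k = x0) &
    forall x, F x -> exists k, e k = x.
Proof.
move=> /card_leP[f].
pose e k := if pselect (exists x : F, val (f x) = k) is left ex
            then val (sval (cid ex)) else x0.
exists e => [k|x Fx].
  rewrite /e; case: pselect => [ex|_]; [left|by right].
  exact/set_mem/(valP (sval (cid ex))).
have Fx' : x \in F by exact/mem_set.
pose u : F := SigSub Fx'.
exists (val (f u)); rewrite /e; case: pselect => [ex|]; last by case; exists u.
have /val_inj fE := svalP (cid ex).
by have -> : sval (cid ex) = u by apply: inj fE; exact: mem_set.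
Qed.

Lemma lt_supremum {d} {O : orderType d} {lam : nat -> O} {l a : O} :
  supremums (range lam) l -> a < l -> exists n, a < lam n.
Proof.
move=> [_ lub] al; apply: contrapT => nE.
move: al; rewrite ltNge => /negP; apply; apply: lub => _ [n _ <-].
by rewrite leNgt; apply/negP => ?; apply: nE; exists n.
Qed.

Section EP.
Context d (O : orderType d) (lam : nat -> O).
Context (lam_cardinal : forall n, is_cardinal (lam n)).
Context (lam_lt : forall m n, (m < n)%N -> lam m < lam n).
Context (U : forall n, set_system (below (lam n))).
Context (normU : forall n, normal_ultrafilter (U n)).

Set Implicit Arguments.
Unset Strict Implicit.

(** * Stems, tails and intersections of measure-one sets *)

Notation point := (forall n, below (lam n)).
Notation sets := (forall n, set (below (lam n))).

(** A stem of length [n] is represented by any full point extending it, so properties of stems have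
    to be invariant under [agree n]. *)
Definition agree n (x y : point) := forall i, (i < n)%N -> x i = y i.

Definition in_tail n (A : sets) (x : point) :=
  forall i, (n <= i)%N -> A i (x i).

Lemma agree_dfwith n x y (a : below (lam n)) :
  agree n x y -> agree n.+1 (dfwith x a) (dfwith y a).
Proof.
move=> xy k; rewrite ltnS leq_eqVlt => /predU1P[->|kn].
  by rewrite !dfwith_in.
by rewrite !dfwith_out ?gtn_eqF// xy.
Qed.

Lemma dfwith_id n (x : point) : dfwith x (x n) = x.
Proof. by apply/functional_extensionality_dep => k; case: dfwithP. Qed.

#[local] Instance U_filter i : ProperFilter (U i).
Proof. by case: (normU i) => -[]. Qed.

Lemma sets_inhabited (A : sets) : (forall i, U i (A i)) ->
  exists x : point, forall i, A i (x i).
Proof.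
move=> UA; have A0 i : A i !=set0 by exact: filter_ex (UA i).
by exists (fun i => sval (cid (A0 i))) => i; exact: svalP.
Qed.

Lemma U_bigcap_ord n i (P : nat -> set (below (lam i))) :
  (forall j, (j < n)%N -> U i (P j)) ->
  U i [set b | forall j, (j < n)%N -> P j b].
Proof.
move=> UP; have : U i [set b | forall j : 'I_n, P j b].
  by apply: filter_forall => j; exact: UP.
by apply: filterS => b Pb j ji; exact: Pb (Ordinal ji).
Qed.

(** As [lam i] is a cardinal above [lam j], a family indexed by [lam j] has fewer than [lam i]
    members, and completeness applies. *)
Lemma U_bigcap_lt j i (P : below (lam j) -> set (below (lam i))) :
  (j < i)%N -> (forall a, U i (P a)) -> U i [set b | forall a, P a b].
Proof.
move=> ji UP; have : U i (\bigcap_(A in range P) A).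
  apply: normal_complete => // [_ [a _ <-] //|le_range].
  apply: (lam_cardinal _ _ (lam_lt _ _ ji)).
  exact: card_le_trans le_range (card_image_le P _).
by apply: filterS => b Pb a; apply: Pb; exists a.
Qed.

(** Instead of counting stems, quantify out their entries one at a time: entry [j < n <= i] costs an
    intersection of length [lam j < lam i]. *)
Lemma U_bigcap_stem n i (P : point -> set (below (lam i))) : (n <= i)%N ->
  (forall x y, agree n x y -> P x `<=` P y) -> (forall x, U i (P x)) ->
  U i [set b | forall x, P x b].
Proof.
elim: n P => [|n IH] P ni Pagree UP.
  have [x _] := @sets_inhabited (fun=> setT) (fun=> filterT).
  by apply: filterS (UP x) => b Pb y; exact: Pagree Pb.
pose Q (y : point) : set (below (lam i)) :=
  [set b | forall a : below (lam n), P (dfwith y a) b].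
have: U i [set b | forall y, Q y b].
  apply: IH => [|x y xy b Qb a|x]; first exact: ltnW.
    by apply: Pagree (Qb a); exact: agree_dfwith.
  exact: U_bigcap_lt.
by apply: filterS => b Qb x; have := Qb x (x n); rewrite dfwith_id.
Qed.

(** * Good stems *)

Definition good_stem (B : set point) n (x : point) :=
  exists2 A : sets, (forall i, U i (A i)) &
    forall y, agree n x y -> in_tail n A y -> ~ B y.

Lemma good_stem_agree B n x y :
  agree n x y -> good_stem B n x -> good_stem B n y.
Proof.
move=> xy [A UA BA]; exists A => // z yz; apply: BA => i ilt.
by rewrite xy// yz.
Qed.

(** Past [n], the witnesses of all [lam n] extensions can be intersected. Entry [n] is the set of
    good extensions, so [y n] selects a witness [W (y n)] that applies to [y]. *)
Lemma good_stem_extend B n x : U n [set a | good_stem B n.+1 (dfwith x a)] ->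
  good_stem B n x.
Proof.
set G := [set a | _] => UG.
have /choice[W HW] (a : below (lam n)) : exists W : sets,
    (forall i, U i (W i)) /\ (G a -> forall y, agree n.+1 (dfwith x a) y ->
      in_tail n.+1 W y -> ~ B y).
  have [[W UW BW]|nG] := pselect (G a); first by exists W.
  by exists (fun=> setT); split => // i; exact: filterT.
(* Entry [n] of the witness is [G], transported from [lam n] to [lam i]. *)
exists (fun i => [set b | (forall a, (n < i)%N -> W a i b)] `&`
  [set b | forall e : n = i, G (ecast i (below (lam i)) (esym e) b)]) => [i|y].
  apply: filterI.
    have [ni|] := boolP (n < i)%N; last by move=> _; exact: filterS filterT.
    have := U_bigcap_lt ni (fun a => (HW a).1 i).
    by apply: filterS => b + a _; exact.
  have [ni|ni] := eqVneq n i; last first.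
    by apply: filterS filterT => b _ e; case/eqP: ni.
  subst i; apply: filterS UG => b Gb e.
  by rewrite eq_axiomK.
move=> xy ty.
have [_ /(_ erefl) /= Gy] := ty n (leqnn _).
apply: (HW (y n)).2 => // i ni.
  move: ni; rewrite ltnS leq_eqVlt => /predU1P[->|ni]; first by rewrite dfwith_in.
  by rewrite dfwith_out ?gtn_eqF// xy.
by have [+ _] := ty i (ltnW ni); exact.
Qed.

(** * The topology in terms of stems and tails *)

Lemma Prikry_nbhd_base n x (A : sets) : (forall i, U i (A i)) ->
  @EPbase _ _ _ _ normU [set y | agree n x y /\ in_tail n A y].
Proof.
move=> UA; exists (fun i => if (i < n)%N then inl (x i) else inr (A i)).
  exists n; split => i ni; first by rewrite ni; exists (x i).
  by rewrite ltnNge ni; exists (A i).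
apply/seteqP; split => y.
  move=> py; split => i ni; move: (py i); first by rewrite ni => ->.
  by rewrite ltnNge ni.
move=> [xy ty] i; case: ltnP => [/xy ->//|/ty//].
Qed.

Lemma EPbaseP (V : set (EPspace normU)) (x : EPspace normU) :
  @EPbase _ _ _ _ normU V -> V x ->
  exists n (A : sets), [/\ forall i, U i (A i), in_tail n A x &
    forall y, agree n x y -> in_tail n A y -> V y].
Proof.
move=> [p [n [pl pr]] <-] px.
(* Below the stem length, [setT] keeps every entry measure-one. *)
exists n, (fun i => if p i is inr A then A else setT); split.
- move=> i; case: (ltnP i n) => [/pl[a ->]|/pr[A UA ->//]]; exact: filterT.
- by move=> i ni; move: (px i); case: (p i).
- move=> y xy ty i; move: (px i).
  case: (ltnP i n) => [ilt|ni].
    by have [a ->] := pl _ ilt; rewrite xy.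
  by move: (ty i ni); have [A _ ->] := pr _ ni.
Qed.

Lemma EPopenP (V : set (EPspace normU)) (x : EPspace normU) :
  open V -> V x ->
  exists n (A : sets), [/\ forall i, U i (A i), in_tail n A x &
    forall y, agree n x y -> in_tail n A y -> V y].
Proof.
move=> [D DE <-] [B DB Bx].
have [n [A [UA tx AB]]] := EPbaseP (DE _ DB) Bx.
by exists n, A; split => // y xy ty; exists B => //; exact: AB.
Qed.

Lemma EPbase_open (V : set (EPspace normU)) :
  @EPbase _ _ _ _ normU V -> open V.
Proof. by move=> bV; exists [set V]; [move=> _ ->|rewrite bigcup_set1]. Qed.

(** * Nowhere dense and meager sets *)

Lemma nowhere_dense_disjoint (B : set (EPspace normU)) n x (A : sets) :
  nowhere_dense B -> (forall i, U i (A i)) ->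
  exists m y, [/\ (n <= m)%N, agree n x y, in_tail n A y & good_stem B m y].
Proof.
move=> ndB UA.
pose V : set (EPspace normU) := [set y | agree n x y /\ in_tail n A y].
have oV : open V by exact/EPbase_open/Prikry_nbhd_base.
have [z Az] := sets_inhabited UA.
have Vz : V (fun i => if (i < n)%N then x i else z i).
  by split => i ni; rewrite ?ni// ltnNge ni/=.
(* An open subset of [closure B] would lie in its interior, which is empty. *)
have : ~ (V `<=` closure B).
  rewrite open_subsetE// => /(_ _ Vz).
  by rewrite ndB.
move=> /existsNP[y /not_implyP[[xy ty] /existsNP[N /not_implyP[+ /set0P/negP]]]].
rewrite nbhsE => -[W [oW Wy] WN]; rewrite negbK => /eqP BN0.
have [k [C [UC tCy CW]]] := EPopenP oW Wy.
(* The stem is lengthened to reach [n]; its entries from [k] on come from [y] and so already lie in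
   [C]. *)
exists (maxn n k), y; split => //; first exact: leq_maxl.
exists C => // w yw tw Bw; suff : set0 w by [].
rewrite -BN0; split => //; apply: WN; apply: CW => i ik.
  by apply: yw; rewrite leq_max ik orbT.
have [ilt|] := ltnP i (maxn n k); first by rewrite -yw//; exact: tCy.
exact: tw.
Qed.

Lemma nowhere_dense_good (B : set (EPspace normU)) n x :
  nowhere_dense B -> good_stem B n x.
Proof.
move=> ndB; apply: contrapT => bad_x.
(* Quantifying over all [t] makes one sequence serve every bad stem, so badness propagates along any
   tail in [A]. *)
pose A i : set (below (lam i)) := [set a | forall t : point,
  ~ good_stem B i t -> ~ good_stem B i.+1 (dfwith t a)].
have UA i : U i (A i).
  apply: (U_bigcap_stem (n := i)) => // [t u tu a + bu|t].
    move=> /(_ (contra_not (good_stem_agree tu) bu)); apply: contra_not.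
    by apply: good_stem_agree; apply: agree_dfwith => k ki; rewrite tu.
  have [g|g] := pselect (good_stem B i t); first exact: filterS filterT.
  have UU := normal_ultra (normU i).
  have [//|] := in_ultra_setVsetC [set a | good_stem B i.+1 (dfwith t a)] UU.
    by move=> /good_stem_extend.
  by apply: filterS => a.
have [m [y [nm xy ty gy]]] := nowhere_dense_disjoint n x ndB UA.
suff: ~ good_stem B m y by [].
rewrite -(subnKC nm); elim: (m - n)%N => [|j IH].
  by rewrite addn0; apply: contra_not bad_x; apply: good_stem_agree => k /xy.
by rewrite addnS -(dfwith_id (n + j) y); exact: ty (leq_addr _ _) _ IH.
Qed.

Lemma nowhere_dense_avoided (B : set (EPspace normU)) : nowhere_dense B ->
  exists2 A : sets, (forall i, U i (A i)) &
    forall n x, in_tail n A x -> ~ B x.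
Proof.
move=> ndB.
have /choice[W HW] (nx : nat * point) : exists W : sets,
    (forall i, U i (W i)) /\
    forall y, agree nx.1 nx.2 y -> in_tail nx.1 W y -> ~ B y.
  by have [W UW BW] := nowhere_dense_good nx.1 nx.2 ndB; exists W.
(* Overwriting by [z] from [n] on makes the chosen witness depend on the stem alone, as
   [U_bigcap_stem] requires. *)
pose r n (z x : point) : point := fun i => if (i < n)%N then x i else z i.
have [z _] := @sets_inhabited (fun=> setT) (fun=> filterT).
exists (fun i => [set b | forall n, (n <= i)%N -> forall x, W (n, r n z x) i b]).
  move=> i; have := @U_bigcap_ord i.+1 i
    (fun n => [set b | forall x, W (n, r n z x) i b]).
  apply => n; rewrite ltnS => ni; apply: (U_bigcap_stem ni) => [x y xy b|x].
    suff -> : r n z x = r n z y by [].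
    apply/functional_extensionality_dep => k; rewrite /r.
    by case: ifP => // /xy.
  exact: (HW (n, r n z x)).1.
move=> n x tx; apply: (HW (n, r n z x)).2 => [i /=|i ni].
  by rewrite /r => ->.
exact: tx.
Qed.

Lemma meager_avoided (l : O) (M : set (EPspace normU)) :
  supremums (range lam) l -> meager_at (below l) M ->
  exists2 A : sets, (forall i, U i (A i)) &
    forall n x, in_tail n A x -> ~ M x.
Proof.
move=> suplam [F [cardF ndF ->]].
have [e eF Fe] := enum_of_card_le F set0 cardF.
have /choice[W HW] (k : below l) : exists W : sets,
    (forall i, U i (W i)) /\ forall n x, in_tail n W x -> ~ e k x.
  have [/ndF/nowhere_dense_avoided[W UW eW]|->] := eF k; first by exists W.
  by exists (fun=> setT); split => [i|n x _ []]; exact: filterT.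
(* Entry [i] handles only pieces whose index lies below some [lam j] with [j < i]. Since the [lam j]
   are cofinal in [l], each piece is handled from some entry on. Comparing [val] identifies ordinals
   across [below l] and [below (lam j)]. *)
exists (fun i => [set b | forall j, (j < i)%N ->
    forall a : below (lam j), forall k : below l, val k = val a -> W k i b]).
  move=> i; apply: U_bigcap_ord => j ji.
  apply: (U_bigcap_lt ji) => a.
  have [[k ka]|nk] := pselect (exists k : below l, val k = val a).
    apply: filterS ((HW k).1 i) => b Wb k'; rewrite -ka => /val_inj.
    by move=> ->.
  by apply: filterS filterT => b _ k ka; case: nk; exists k.
move=> n x tx [B /Fe[k <-]].
have [j kj] := lt_supremum suplam (valP k).
apply: (HW k).2 (maxn n j.+1) _ _ => i; rewrite geq_max => /andP[ni ji].
exact: tx ni j ji (Sub (val k) kj) k erefl.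
Qed.

(** * A set without the Baire property *)

Definition eventually_equal (x y : point) :=
  exists n, forall i, (n <= i)%N -> x i = y i.

Definition representative (x0 x : point) : EPspace normU :=
  xget (x0 : EPspace normU) [set y | eventually_equal x y].

Lemma representativeP x0 x : eventually_equal x (representative x0 x).
Proof.
apply: (@xgetPex (EPspace normU) x0 (eventually_equal x)).
by exists x; exists 0%N.
Qed.

Lemma representative_eq x0 x y :
  eventually_equal x y -> representative x0 x = representative x0 y.
Proof.
move=> [n xy]; rewrite /representative; congr xget; apply/seteqP.
split => z [m zm]; exists (maxn n m) => i; rewrite geq_max => /andP[ni mi].
  by rewrite -xy// zm.
by rewrite xy// zm.
Qed.

Definition last_difference x0 (x : point) k :=
  x k <> representative x0 x k /\
  forall i, (k < i)%N -> x i = representative x0 x i.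

Lemma last_difference_uniq x0 x k k' :
  last_difference x0 x k -> last_difference x0 x k' -> k = k'.
Proof.
by move=> [xk xgtk] [xk' xgtk']; case: (ltngtP k k') => [/xgtk|/xgtk'|].
Qed.

Lemma last_difference_parity x0 n x (A : sets) (b : bool) :
  (forall i, U i (A i)) -> exists y k,
    [/\ agree n x y, in_tail n A y, last_difference x0 y k & odd k = b].
Proof.
move=> UA; have [z Az] := sets_inhabited UA.
pose w : point := fun i => if (i < n)%N then x i else z i.
have [N wN] := representativeP x0 w.
(* An index of parity [b], beyond the stem and beyond all differences of [w] from its
   representative. *)
pose k := (b + (maxn n N).*2)%N.
have nk : (maxn n N <= k)%N by rewrite /k -addnn addnA leq_addl.
move: (nk); rewrite geq_max => /andP[nlek Nk].
(* Otherwise [A k] would be contained in a singleton, against nonprincipality. *)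
have [c Ac cr] : exists2 c, A k c & c <> representative x0 w k.
  apply: contrapT => nc; apply: (@normal_nonprincipal _ _ _ _ (normU k)
    (representative x0 w k)); apply: filterS (UA k) => c Ac.
  by apply: contrapT => cr; apply: nc; exists c.
(* Changing one entry keeps the class, so [k] becomes the last difference. *)
have ry : representative x0 (dfwith w c) = representative x0 w.
  apply: representative_eq; exists k.+1 => i ki.
  by rewrite dfwith_out// ltn_eqF.
exists (dfwith w c), k; split.
- by move=> i ilt; rewrite dfwith_out ?gtn_eqF ?(leq_trans ilt)// /w ilt.
- move=> i ni; move: ni; case: dfwithP => // j _ nj.
  by rewrite /w ltnNge nj /=.
- rewrite /last_difference ry dfwith_in; split => // i ki.
  by rewrite dfwith_out ?ltn_eqF// wN// (leq_trans Nk)// ltnW.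
- by rewrite /k oddD odd_double addbF; case: (b).
Qed.

Definition odd_last_difference x0 : set (EPspace normU) :=
  [set x | exists2 k, odd k & last_difference x0 x k].

(** An empty [V] misses an odd point with tail in [A]; a nonempty [V] contains an even one. Either
    point lies in the symmetric difference, which [A] avoids. *)
Lemma odd_last_difference_not_Baire x0 (l : O) :
  supremums (range lam) l -> ~ EP_Baire_property l (odd_last_difference x0).
Proof.
move=> suplam [V oV /(meager_avoided suplam)[A UA AV]].
have [V0|/set0P[x Vx]] := eqVneq V set0.
  have [y [k [_ ty ky oddk]]] := last_difference_parity x0 0 x0 true UA.
  by apply: (AV 0%N y ty); left; split; [exists k|rewrite V0].
have [n [C [UC _ CV]]] := EPopenP oV Vx.
have UAC i : U i (A i `&` C i) by exact: filterI.
have [y [k [xy ty ky evenk]]] := last_difference_parity x0 n x false UAC.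
apply: (AV n y) => [i /ty[]//|]; right; split.
  by apply: CV => // i /ty[].
by move=> [k' oddk' /(last_difference_uniq ky) kk']; rewrite -kk' evenk in oddk'.
Qed.

End EP.

Theorem theorem4p5
    (d : Order.disp_t) (O : orderType d) (wo : well_order (<=%O : rel O))
    (lam : nat -> O) (l : O)
    (lam_measurable : forall n : nat, measurable_cardinal (lam n))
    (lam_increasing : forall m n : nat, (m < n)%N -> lam m < lam n)
    (lam_limit : supremums (range lam) l)
    (U : forall n : nat, set_system (below (lam n)))
    (normU : forall n : nat, normal_ultrafilter (U n)) :
  exists A : set (EPspace normU), ~ EP_Baire_property l A.
Proof.
have lam_cardinal n : is_cardinal (lam n) by case: (lam_measurable n).
have UT n : U n setT by have := U_filter normU n => ?; exact: filterT.
have [x0 _] := sets_inhabited normU UT.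
exists (@odd_last_difference _ _ _ _ normU x0).
exact: odd_last_difference_not_Baire.
Qed.
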